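(* Let $G$ be a graph. The set $\mathcal{S}_L(G)$ contains a matrix with the SSPWL if and only if $G$ is connected.
   Context: Graphs are finite and simple. For a graph $G$ on vertex set $\{1,\ldots,n\}$, $\mathcal{S}_L(G)$ denotes the set of weighted Laplacian matrices of $G$: all $n\times n$ real symmetric matrices $A=[a_{i,j}]$ with, for $i\ne j$, $a_{i,j}<0$ if $\{i,j\}\in E(G)$ and $a_{i,j}=0$ if $\{i,j\}\notin E(G)$, and with $a_{i,i}=-\sum_{k:\{k,i\}\in E(G)}a_{i,k}$ for all $i$. Let $J$ be the $n\times n$ all-ones matrix and $H=I-\frac1n J$. A matrix $A\in\mathcal{S}_L(G)$ has the strong spectral property for weighted Laplacian matrices (SSPWL) if $X=O$ is the only real symmetric $n\times n$ matrix satisfying $A\circ X=I\circ X=O$ and $H(AX-XA)H=O$, where $\circ$ is the entrywise product. *)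

(* Defs.v *)
From HB Require Import structures.
From mathcomp Require Import all_boot all_order all_algebra.
From mathcomp Require Import reals.
Set Implicit Arguments.
Unset Strict Implicit.
Unset Printing Implicit Defensive.
Import Order.TTheory GRing.Theory Num.Theory.
Local Open Scope ring_scope.

(* A simple graph on n vertices is a symmetric irreflexive adjacency relation
   on 'I_n. *)
Definition simple_graph (n : nat) (e : rel 'I_n) : Prop :=
  symmetric e /\ irreflexive e.

Definition connected_graph (n : nat) (e : rel 'I_n) : Prop :=
  forall i j : 'I_n, connect e i j.

Definition weighted_laplacian (R : realType) (n : nat) (e : rel 'I_n)
    (A : 'M[R]_n) : Prop :=
  [/\ A^T = A,
      forall i j : 'I_n, i != j -> e i j -> A i j < 0,
      forall i j : 'I_n, i != j -> ~~ e i j -> A i j = 0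
    & forall i : 'I_n, A i i = - \sum_(k | e k i) A i k].

(* Entrywise (Schur) product. *)
Definition hadamard (R : realType) (n : nat) (A B : 'M[R]_n) : 'M[R]_n :=
  map2_mx *%R A B.

(* The projection I - n^-1 J, where J is the all-ones matrix. *)
Definition centering_mx (R : realType) (n : nat) : 'M[R]_n :=
  1%:M - n%:R^-1 *: const_mx 1.

Definition SSPWL (R : realType) (n : nat) (A : 'M[R]_n) : Prop :=
  forall X : 'M[R]_n,
    X^T = X ->
    hadamard A X = 0 ->
    hadamard 1%:M X = 0 ->
    centering_mx R n *m (A *m X - X *m A) *m centering_mx R n = 0 ->
    X = 0.

(* Main.v *)
Require Import Defs.
From HB Require Import structures.
From mathcomp Require Import all_boot all_order all_algebra.
From mathcomp Require Import reals.
From mathcomp Require Import ring lra.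
Set Implicit Arguments.
Unset Strict Implicit.
Unset Printing Implicit Defensive.
Import Order.TTheory GRing.Theory Num.Theory.
Local Open Scope ring_scope.

(** If the graph is disconnected, with a component S, then the symmetric 0-1
    matrix X marking the pairs that S separates avoids the diagonal and the
    edges.  Each column of X is constant on components, hence killed by A, so
    AX = XA = 0 with X nonzero: no weighted Laplacian has the SSPWL
    ([connected_of_SSPWL]).

    Conversely, a skew-symmetric matrix K satisfies HKH = 0 exactly when it is
    a difference matrix K_ij = u_i - u_j.  This can be tested without naming
    the vector u, by the cocycle identity K_ij + K_jr + K_ri = 0 for a fixed
    root r, and the test makes sense on a subset S of the vertices.  It gives
    a relative form of the SSPWL, [rigid_on], for weighted Laplacians of the
    subgraph induced on S.  A rigid Laplacian is then grown one vertex at a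
    time, starting from the single vertex r.  Let v be a vertex outside S with
    a neighbour p in S, and let B be the Laplacian of the star formed by the
    edges from v to S.

    The matrix A, with weight 0 on the star, is already rigid on S + v
    provided X is required to vanish on the star ([rigid_on_add_vertex]): the
    S-by-S block of X vanishes by induction, and then the column of X at v
    is in the kernel of A, hence constant on the connected set S, and it
    vanishes at p.  Rigidity says that a linear map of X, depending linearly on
    A, is injective on a fixed subspace.  Injectivity survives small
    perturbations ([injective_perturb]), so A + eps B is rigid on S + v for
    some eps > 0, and it is a weighted Laplacian of the subgraph induced on
    S + v. *)

(** * Perturbation of injective linear maps *)

(** Modulo a right inverse C of F, a row vector killed by F + eps G is an
    eigenvector of GC for -1/eps, and the characteristic polynomial has
    finitely many roots. *)
Lemma row_free_perturb (R : numFieldType) (p q : nat) (F G : 'M[R]_(p, q)) :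
  row_free F -> exists2 eps : R, 0 < eps & row_free (F + eps *: G).
Proof.
case/row_freeP=> C FC1; set P := char_poly (G *m C).
pose z (k : nat) : R := - k.+1%:R.
have z_inj : injective z by move=> a b /oppr_inj/eqP; rewrite eqr_nat => /eqP[].
have nzP : P != 0 by rewrite monic_neq0 ?char_poly_monic.
have [k nPk] : exists k, ~~ root P (z k).
  have [/hasP[k _ nPk]|] :=
    boolP (has (fun k => ~~ root P (z k)) (iota 0 (size P))).
    by exists k.
  rewrite -all_predC => all_root.
  have rts : all (root P) (map z (iota 0 (size P))).
    rewrite all_map; apply: sub_all all_root => k /=; by rewrite negbK.
  have := max_poly_roots nzP rts.
  by rewrite map_inj_uniq // iota_uniq size_map size_iota ltnn => /(_ isT).
exists k.+1%:R^-1; first by rewrite invr_gt0 ltr0n.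
apply: inj_row_free => x x0; apply/eqP; apply: contraR nPk => x_neq0.
rewrite -eigenvalue_root_char; apply/eigenvalueP; exists x => //.
have /(congr1 (mulmxr C)) : x *m (F + k.+1%:R^-1 *: G) = 0 by [].
rewrite /= mul0mx -mulmxA mulmxDl FC1 -scalemxAl mulmxDr mulmx1 -scalemxAr.
move/(congr1 ( *:%R k.+1%:R)).
rewrite scaler0 scalerDr scalerA divff ?pnatr_eq0 // scale1r => /eqP.
by rewrite addrC addr_eq0 -scaleNr => /eqP.
Qed.

Lemma injective_perturb (R : numFieldType) (m n p q : nat)
    (h f g : {linear 'M[R]_(m, n) -> 'M[R]_(p, q)}) :
  (forall X, h X = 0 -> f X = 0 -> X = 0) ->
  exists2 eps : R, 0 < eps &
    forall X, h X = 0 -> f X + eps *: g X = 0 -> X = 0.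
Proof.
move=> inj0.
pose F := row_mx (lin_mx h) (lin_mx f); pose G : 'M_(m * n, p * q + p * q) := row_mx 0 (lin_mx g).
have /row_free_perturb - /(_ G)[eps eps_gt0 free_eps] : row_free F.
  apply: inj_row_free => x; rewrite -[x]vec_mxK mul_mx_row !mul_vec_lin.
  rewrite -row_mx0 => /eq_row_mx[hx fx]; apply/eqP; rewrite mxvec_eq0.
  by apply/eqP/inj0; apply/eqP; rewrite -mxvec_eq0 ?hx ?fx.
exists eps => // X hX fgX; apply/eqP; rewrite -mxvec_eq0 -(mulmx_free_eq0 _ free_eps).
rewrite scale_row_mx add_row_mx scaler0 addr0 mul_mx_row mulmxDr -scalemxAr.
by rewrite !mul_vec_lin hX -linearZ -linearD fgX !linear0 row_mx0.
Qed.

(** * Weighted Laplacians *)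

Section Laplacian.
Variables (R : realType) (n : nat).
Implicit Types (e : rel 'I_n) (A B X K : 'M[R]_n) (S : {set 'I_n}).

Lemma weighted_laplacian_sum0 e A : irreflexive e ->
  (weighted_laplacian e A <->
   [/\ A^T = A, forall i j, i != j -> e i j -> A i j < 0,
       forall i j, i != j -> ~~ e i j -> A i j = 0
     & forall i, \sum_k A i k = 0]).
Proof.
move=> irr.
suff diagE : A^T = A -> (forall i j, i != j -> ~~ e i j -> A i j = 0) ->
    forall i, \sum_k A i k = A i i + \sum_(k | e k i) A i k.
  split=> [[sA neg zero dA]|[sA neg zero dA]]; split=> // i.
    by rewrite diagE // dA addNr.
  by apply/eqP; rewrite -addr_eq0 -diagE // dA.
move=> sA zero i; rewrite (bigD1 i) //=; congr (_ + _).
rewrite big_mkcond [RHS]big_mkcond; apply: eq_bigr => k _.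
case: eqVneq => [->|ki] /=; first by rewrite irr.
by case: ifP => // /negbT eki; rewrite -sA mxE zero.
Qed.

Lemma weighted_laplacian_sym e A i j :
  weighted_laplacian e A -> A i j = A j i.
Proof. by case=> sA _ _ _; rewrite -{1}sA mxE. Qed.

(** The rows of A sum to 0, so f may be replaced by its value at the row
    index. *)
Lemma weighted_laplacian_mul_const e A (f : 'I_n -> R) i :
  irreflexive e -> weighted_laplacian e A ->
  (forall k, e i k -> f k = f i) -> \sum_k A i k * f k = 0.
Proof.
move=> irr /(weighted_laplacian_sum0 _ irr)[_ _ zero sum0] fE.
rewrite (eq_bigr (fun k => A i k * f i)) => [|k _].
  by rewrite -mulr_suml sum0 mul0r.
have [->//|ik] := eqVneq i k.
by have [/fE->//|nik] := boolP (e i k); rewrite zero ?mul0r.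
Qed.

(** The Dirichlet form: twice y^T A y equals the sum of -A_ij (y_i - y_j)^2,
    whose terms are all nonnegative. *)
Lemma weighted_laplacian_ker e A (y : 'I_n -> R) :
  irreflexive e -> weighted_laplacian e A ->
  (forall i, \sum_k A i k * y k = 0) -> forall i j, e i j -> y i = y j.
Proof.
move=> irr wA Ay0; have /(weighted_laplacian_sum0 _ irr)[_ neg zero sum0] := wA.
have sum0' j : \sum_i A i j = 0.
  rewrite -[RHS](sum0 j); apply: eq_bigr => i _.
  exact: weighted_laplacian_sym wA.
have term_ge0 i j : 0 <= - A i j * (y i - y j) ^+ 2.
  have [->|ij] := eqVneq i j; first by rewrite subrr expr0n mulr0.
  rewrite mulr_ge0 ?sqr_ge0 // oppr_ge0.
  by have [/(neg _ _ ij)/ltW//|/(zero _ _ ij)->] := boolP (e i j).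
have form0 : \sum_i \sum_j - A i j * (y i - y j) ^+ 2 = 0.
  have -> : \sum_i \sum_j - A i j * (y i - y j) ^+ 2 =
      \sum_i (2 * y i * \sum_j A i j * y j)
      - \sum_i (y i ^+ 2 * \sum_j A i j) - \sum_j (y j ^+ 2 * \sum_i A i j).
    under [X in _ - X]eq_bigr => j _ do rewrite mulr_sumr.
    rewrite [X in _ - X]exchange_big /= -!sumrB; apply: eq_bigr => i _.
    rewrite !mulr_sumr -!sumrB; apply: eq_bigr => j _; ring.
  by rewrite !big1 ?subrr // => i _; rewrite ?sum0 ?sum0' ?Ay0 mulr0.
move=> i j eij; have ij : i != j by apply: contraTneq eij => ->; rewrite irr.
have /psumr_eq0P - /(_ _ i isT) row0 := form0.
have {row0}/psumr_eq0P - /(_ _ j isT) t0 :=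
  row0 (fun i _ => sumr_ge0 _ (fun j _ => term_ge0 i j)).
have /eqP := t0 (fun j _ => term_ge0 i j).
rewrite mulf_eq0 oppr_eq0 sqrf_eq0 subr_eq0 => /orP[|/eqP//].
by rewrite (negPf (ltr0_neq0 (neg _ _ ij eij))).
Qed.

Definition unit_laplacian e : 'M[R]_n :=
  \matrix_(i, j) ((i == j)%:R * (\sum_k (e i k)%:R) - (e i j)%:R).

Lemma unit_laplacianP e : symmetric e -> irreflexive e ->
  weighted_laplacian e (unit_laplacian e).
Proof.
move=> sym irr; apply/weighted_laplacian_sum0 => //; split.
- apply/matrixP=> i j; rewrite !mxE eq_sym sym.
  by case: eqVneq => [->//|_]; rewrite !mul0r.
- by move=> i j ij eij; rewrite mxE (negPf ij) eij mul0r sub0r ltrN10.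
- by move=> i j ij eij; rewrite mxE (negPf ij) (negPf eij) mul0r subrr.
move=> i; under eq_bigr => k _ do rewrite mxE.
rewrite sumrB -mulr_suml (bigD1 i) //= eqxx big1 ?addr0 ?mul1r ?subrr // => k.
by rewrite eq_sym => /negPf->.
Qed.

Lemma weighted_laplacianD e1 e2 A B eps : irreflexive e1 -> irreflexive e2 ->
  weighted_laplacian e1 A -> weighted_laplacian e2 B -> 0 < eps ->
  weighted_laplacian [rel i j | e1 i j || e2 i j] (A + eps *: B).
Proof.
move=> irr1 irr2 /(weighted_laplacian_sum0 _ irr1)[sA nA zA s0A].
move=> /(weighted_laplacian_sum0 _ irr2)[sB nB zB s0B] eps_gt0.
apply/weighted_laplacian_sum0 => [i|]; first by rewrite /= irr1 irr2.
have leA i j : i != j -> A i j <= 0.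
  by move=> ij; have [/(nA _ _ ij)/ltW//|/(zA _ _ ij)->] := boolP (e1 i j).
have leB i j : i != j -> B i j <= 0.
  by move=> ij; have [/(nB _ _ ij)/ltW//|/(zB _ _ ij)->] := boolP (e2 i j).
split=> [|i j ij /orP[e1ij|e2ij]|i j ij|i].
- by rewrite linearD linearZ /= sA sB.
- by rewrite !mxE ltr_wnDr ?nA // pmulr_rle0 ?leB.
- by rewrite !mxE ltr_wnDl ?leA // pmulr_rlt0 ?nB.
- by rewrite negb_or => /andP[? ?]; rewrite !mxE zA ?zB // mulr0 addr0.
under eq_bigr => k _ do rewrite !mxE.
by rewrite big_split /= s0A -mulr_sumr s0B mulr0 addr0.
Qed.

(** * Disconnected graphs *)

Lemma connected_of_SSPWL e A : simple_graph e ->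
  weighted_laplacian e A -> SSPWL A -> connected_graph e.
Proof.
move=> [sym irr] wA sspwl i j; apply/negPn/negP => nij.
have [sA _ zero _] := wA.
pose sep a b := connect e i a (+) connect e i b.
have sep_edge a b c : e a b -> sep b c = sep a c.
  move=> eab; rewrite /sep; congr (_ (+) _); apply/idP/idP => cx.
    by apply: connect_trans cx (connect1 _); rewrite sym.
  exact: connect_trans cx (connect1 eab).
pose X : 'M[R]_n := \matrix_(a, b) (sep a b)%:R.
have sX : X^T = X by apply/matrixP=> a b; rewrite !mxE /sep addbC.
have AX0 : A *m X = 0.
  apply/matrixP=> a b; rewrite !mxE.
  apply: (weighted_laplacian_mul_const irr wA) => k eak.
  by rewrite !mxE (sep_edge _ _ _ eak).
have XA0 : X *m A = 0 by rewrite -sA -sX -trmx_mul AX0 trmx0.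
suff : X = 0.
  move/matrixP/(_ i j)/eqP.
  by rewrite !mxE /sep connect0 (negPf nij) oner_eq0.
apply: sspwl => //.
- apply/matrixP=> a b; rewrite !mxE.
  have [->|ab] := eqVneq a b; first by rewrite /sep addbb mulr0.
  have [eab|nab] := boolP (e a b); last by rewrite zero ?mul0r.
  by rewrite -(sep_edge _ _ _ eab) /sep addbb mulr0.
- apply/matrixP=> a b; rewrite !mxE.
  by have [->|_] := eqVneq a b; rewrite ?mul0r // /sep addbb mulr0.
by rewrite AX0 XA0 subrr mulmx0 mul0mx.
Qed.

(** * Rigidity relative to a set of vertices *)

Definition commutator_mx A X : 'M[R]_n := A *m X - X *m A.

Definition nonedge_in e S : rel 'I_n :=
  [rel i j | [&& i \in S, j \in S, i != j & ~~ e i j]].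

(** The defect of X from being symmetric and supported on the non-edges inside
    S, as a linear map of X. *)
Definition support_defect e S X : 'M[R]_n :=
  \matrix_(i, j) (X i j - if nonedge_in e S i j then X j i else 0).

(** For r in S, its vanishing says that K coincides on S with a difference
    matrix u_i - u_j, with u_i = K_ir. *)
Definition cocycle_defect S (r : 'I_n) K : 'M[R]_n :=
  \matrix_(i, j) if (i \in S) && (j \in S) then K i j + K j r + K r i else 0.

Definition rigid_on e S r A : Prop :=
  forall X, support_defect e S X = 0 ->
    cocycle_defect S r (commutator_mx A X) = 0 -> X = 0.

Lemma support_defect_is_linear e S : linear (support_defect e S).
Proof.
by move=> a X Y; apply/matrixP=> i j; rewrite !mxE; case: ifP => _; ring.
Qed.

HB.instance Definition _ e S :=
  GRing.isLinear.Build R 'M[R]_n 'M[R]_n _ (support_defect e S)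
    (support_defect_is_linear e S).

Lemma cocycle_defect_is_linear S r : linear (cocycle_defect S r).
Proof.
by move=> a X Y; apply/matrixP=> i j; rewrite !mxE; case: ifP => _; ring.
Qed.

HB.instance Definition _ S r :=
  GRing.isLinear.Build R 'M[R]_n 'M[R]_n _ (cocycle_defect S r)
    (cocycle_defect_is_linear S r).

Lemma commutator_mx_is_linear A : linear (commutator_mx A).
Proof.
move=> a X Y; rewrite /commutator_mx mulmxDr mulmxDl -scalemxAr -scalemxAl.
by rewrite scalerBr opprD addrACA.
Qed.

HB.instance Definition _ A :=
  GRing.isLinear.Build R 'M[R]_n 'M[R]_n _ (commutator_mx A)
    (commutator_mx_is_linear A).

Lemma commutator_mx_perturb A B X eps :
  commutator_mx (A + eps *: B) X = commutator_mx A X + eps *: commutator_mx B X.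
Proof.
rewrite /commutator_mx mulmxDr mulmxDl -scalemxAr -scalemxAl.
by rewrite scalerBr opprD addrACA.
Qed.

Lemma support_defect_eq0 e S X : symmetric e ->
  support_defect e S X = 0 <->
  X^T = X /\ (forall i j, ~~ nonedge_in e S i j -> X i j = 0).
Proof.
move=> sym; have ne_sym i j : nonedge_in e S i j = nonedge_in e S j i.
  by rewrite /nonedge_in /= sym eq_sym; case: (i \in S); case: (j \in S).
split=> [/matrixP X0|[sX X0]]; last first.
  apply/matrixP=> i j; rewrite !mxE -{1}sX mxE.
  case: ifP => [_|/negbT nij]; first by rewrite subrr.
  by rewrite X0 ?subr0 // ne_sym.
have X0' i j : ~~ nonedge_in e S i j -> X i j = 0.
  by move=> nij; have := X0 i j; rewrite !mxE (negPf nij) subr0.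
split=> //; apply/matrixP=> i j; rewrite mxE.
have [nij|nij] := boolP (nonedge_in e S i j); last first.
  by rewrite !X0' // ne_sym.
by have /eqP := X0 i j; rewrite !mxE nij subr_eq0 => /eqP->.
Qed.

Lemma rigid_on_perturb e S r A B : rigid_on e S r A ->
  exists2 eps : R, 0 < eps & rigid_on e S r (A + eps *: B).
Proof.
move=> rigA.
have [eps eps_gt0 inj] := @injective_perturb R n n n n (support_defect e S)
  (cocycle_defect S r \o commutator_mx A)
  (cocycle_defect S r \o commutator_mx B) rigA.
exists eps => // X hX; rewrite commutator_mx_perturb linearD linearZ.
exact: inj.
Qed.

Definition induced_rel e S : rel 'I_n :=
  [rel i j | [&& i \in S, j \in S & e i j]].

Lemma weighted_laplacian_induced0 e S A i j : irreflexive e ->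
  weighted_laplacian (induced_rel e S) A ->
  (i \notin S) || (j \notin S) -> A i j = 0.
Proof.
move=> irr [_ _ zero diag] ijS.
have nij : ~~ induced_rel e S i j.
  by rewrite /induced_rel /= andbA negb_and negb_and ijS.
have [eij|] := eqVneq i j; last by move=> ij; rewrite zero.
move: ijS; rewrite -eij orbb => iS; rewrite diag big_pred0 ?oppr0 // => k.
by rewrite /induced_rel /= (negPf iS) andbF.
Qed.

(** Here A still gives weight 0 to the edges from v to S, but X is required
    to vanish on them. *)
Lemma rigid_on_add_vertex e S r v p A : simple_graph e ->
  weighted_laplacian (induced_rel e S) A ->
  (forall y : 'I_n -> R, (forall i j, induced_rel e S i j -> y i = y j) ->
     {in S &, forall i j, y i = y j}) ->
  r \in S -> p \in S -> v \notin S -> e p v ->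
  rigid_on e S r A -> rigid_on e (v |: S) r A.
Proof.
move=> [sym irr] wA connS rS pS vS epv rigA X.
move=> /support_defect_eq0 - /(_ sym)[sX X0] coc.
have irrS : irreflexive (induced_rel e S).
  by move=> i; rewrite /induced_rel /= irr !andbF.
have A0 i j : (i \notin S) || (j \notin S) -> A i j = 0.
  exact: weighted_laplacian_induced0 irr wA.
have sXij i j : X i j = X j i by rewrite -{1}sX mxE.
have {}coc i j : i \in v |: S -> j \in v |: S -> commutator_mx A X i j
    + commutator_mx A X j r + commutator_mx A X r i = 0.
  by move=> iS jS; move/matrixP/(_ i j): coc; rewrite !mxE iS jS.
(* The block of X on S satisfies the hypotheses of rigidity on S. *)
pose Y : 'M[R]_n := \matrix_(i, j) if (i \in S) && (j \in S) then X i j else 0.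
have commE i j : i \in S -> j \in S ->
    commutator_mx A Y i j = commutator_mx A X i j.
  move=> iS jS; rewrite !mxE; congr (_ - _); apply: eq_bigr => k _; rewrite mxE.
    by rewrite jS andbT; case: ifPn => // kS; rewrite A0 ?kS ?orbT ?mul0r.
  by rewrite iS; case: ifPn => // kS; rewrite A0 ?kS ?mulr0.
have Y0 : Y = 0.
  apply: rigA.
    apply/support_defect_eq0=> //; split=> [|i j nij].
      by apply/matrixP=> i j; rewrite !mxE andbC sXij.
    rewrite mxE; case: ifP => // /andP[iS jS]; apply: X0.
    by move: nij; rewrite /nonedge_in /= !in_setU1 iS jS !orbT.
  apply/matrixP=> i j; rewrite mxE [RHS]mxE; case: ifP => // /andP[iS jS].
  by rewrite !commE // coc // in_setU1 ?iS ?jS orbT.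
have XS i j : i \in S -> j \in S -> X i j = 0.
  by move=> iS jS; move/matrixP/(_ i j): Y0; rewrite !mxE iS jS.
have comm0 i j : i \in S -> j \in S -> commutator_mx A X i j = 0.
  by move=> iS jS; rewrite -commE // Y0 linear0 mxE.
(* It remains to treat the column of X at v. *)
pose y (i : 'I_n) : R := X i v.
have Ay i : commutator_mx A X i v = \sum_k A i k * y k.
  rewrite !mxE [X in _ - X]big1 ?subr0 // => k _.
  by rewrite A0 ?mulr0 // vS orbT.
pose c := \sum_k A r k * y k.
have AyS i : i \in S -> \sum_k A i k * y k = c.
  have commv k : k \in S -> commutator_mx A X k v = - commutator_mx A X v r.
    move=> kS; have := coc k v (setU1r _ kS) (setU11 _ _).
    by rewrite (comm0 r k) // addr0 => /eqP; rewrite addr_eq0 => /eqP.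
  by move=> iS; rewrite /c -!Ay !commv.
have c0 : c = 0.
  (* The entries of Ay sum to 0, and they equal c on S and 0 off S. *)
  have /(weighted_laplacian_sum0 _ irrS)[_ _ _ sum0] := wA.
  have tot0 : \sum_i \sum_k A i k * y k = 0.
    rewrite exchange_big big1 // => k _; rewrite -mulr_suml.
    under eq_bigr => i _ do rewrite (weighted_laplacian_sym _ _ wA).
    by rewrite sum0 mul0r.
  move/eqP: tot0; rewrite (bigID (mem S)) /= [X in _ + X]big1 => [|i iS].
    rewrite addr0 (eq_bigr (fun=> c)) // sumr_const mulrn_eq0 => /orP[|/eqP//].
    by rewrite cards_eq0 => /eqP S0; move: rS; rewrite S0 inE.
  by rewrite big1 // => k _; rewrite A0 ?iS ?mul0r.
have Ay0 i : \sum_k A i k * y k = 0.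
  have [iS|iS] := boolP (i \in S); first by rewrite AyS.
  by rewrite big1 // => k _; rewrite A0 ?iS ?mul0r.
have yp : y p = 0 by apply: X0; rewrite /nonedge_in /= epv !andbF.
have yS i : i \in S -> y i = 0.
  move=> iS; rewrite -yp; apply: connS => //.
  exact: (weighted_laplacian_ker irrS wA Ay0).
apply/matrixP=> i j; rewrite mxE.
have [|/X0//] := boolP (nonedge_in e (v |: S) i j).
rewrite /nonedge_in /= !in_setU1 => /and4P[/orP[/eqP->|iS] /orP[/eqP->|jS] ij _].
- by rewrite X0 // /nonedge_in /= eqxx !andbF.
- by rewrite sXij; apply: yS.
- exact: yS.
- exact: XS.
Qed.

(** The conjunct on functions y says that the subgraph induced on S is
    connected, in the form in which it applies to kernel vectors. *)
Lemma exists_rigid_laplacian e r : simple_graph e -> connected_graph e ->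
  exists A, weighted_laplacian e A /\ rigid_on e setT r A.
Proof.
move=> he conn; have [sym irr] := he.
suff grow m : forall S, #|~: S| = m -> r \in S ->
    (forall y : 'I_n -> R, (forall i j, induced_rel e S i j -> y i = y j) ->
       {in S &, forall i j, y i = y j}) ->
    (exists A, weighted_laplacian (induced_rel e S) A /\ rigid_on e S r A) ->
    exists A, weighted_laplacian e A /\ rigid_on e setT r A.
  apply: (grow _ [set r] erefl).
  - exact: set11.
  - by move=> y _ i j /set1P-> /set1P->.
  exists 0; split.
    apply/weighted_laplacian_sum0; first by move=> i; rewrite /induced_rel /= irr !andbF.
    split=> [|i j ij|i j|i]; rewrite ?trmx0 //.
    - by rewrite /= => /and3P[/set1P iE /set1P jE]; rewrite iE jE eqxx in ij.
    - by rewrite mxE.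
    by rewrite big1 // => k _; rewrite mxE.
  move=> X /support_defect_eq0 - /(_ sym)[_ X0] _; apply/matrixP=> i j.
  rewrite mxE X0 //; apply/negP => /and4P[/set1P-> /set1P->].
  by rewrite eqxx.
elim: m => [|m IHm] S cardS rS connS [A [wA rigA]].
  have ST : S = setT.
    apply/eqP.
    by rewrite -subTset -setC0 -setCS setCK subset0 -cards_eq0 cardS.
  exists A; rewrite ST in wA rigA; split=> //.
  have indT : induced_rel e setT =2 e by move=> i j; rewrite /induced_rel /= !inE.
  have [sA neg zero diag] := wA; split=> // [i j ij|i j ij|i].
  - by rewrite -indT; exact: neg.
  - by rewrite -indT; exact: zero.
  by rewrite diag; congr (- _); apply: eq_bigl => k; exact: indT.
have [p [v [pS vS epv]]] : exists p v, [/\ p \in S, v \notin S & e p v].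
  have /card_gt0P[x] : (0 < #|~: S|)%N by rewrite cardS.
  rewrite inE => xS.
  have [/existsP[p /existsP[v /and3P[pS vS epv]]]|none] :=
    boolP [exists p, exists v, [&& p \in S, v \notin S & e p v]].
    by exists p, v.
  have cl i j : e i j -> i \in S -> j \in S.
    move=> eij iS; apply: contraR none => jS.
    by apply/existsP; exists i; apply/existsP; exists j; rewrite iS jS.
  have clS : closed e (mem S).
    by move=> i j eij; apply/idP/idP; apply: cl; rewrite // sym.
  by have := closed_connect clS (conn r x); rewrite /= rS (negPf xS).
pose star : rel 'I_n :=
  [rel i j | e i j && ((i == v) && (j \in S) || (j == v) && (i \in S))].
have star_sym : symmetric star by move=> i j; rewrite /star /= sym orbC.
have star_irr : irreflexive star by move=> i; rewrite /star /= irr.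
have irrS : irreflexive (induced_rel e S).
  by move=> i; rewrite /induced_rel /= irr !andbF.
have starE : [rel i j | induced_rel e S i j || star i j] =2 induced_rel e (v |: S).
  move=> i j; rewrite /star /induced_rel /= !in_setU1.
  have [->|iv] := eqVneq i v; have [->|jv] := eqVneq j v;
    rewrite ?irr ?(negPf vS) ?orbF //=.
  - by rewrite andbC.
  - by rewrite andbF andbC.
  by rewrite ?andbF ?orbF.
have rig0 := rigid_on_add_vertex he wA connS rS pS vS epv rigA.
have [eps eps_gt0 rig] := rigid_on_perturb (unit_laplacian star) rig0.
apply: (IHm (v |: S)).
- have := cardsD1 v (~: S); rewrite cardS inE vS add1n => -[->].
  by congr #|pred_of_set _|; apply/setP=> x; rewrite !inE negb_or.
- by rewrite in_setU1 rS orbT.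
- move=> y yE.
  have yS : {in S &, forall i j, y i = y j}.
    apply: connS => i j /and3P[iS jS eij]; apply: yE.
    by rewrite /induced_rel /= !in_setU1 iS jS eij !orbT.
  have yv : y v = y p.
    by apply: yE; rewrite /induced_rel /= !in_setU1 eqxx pS orbT sym.
  have yp i : i \in v |: S -> y i = y p.
    by case/setU1P=> [->//|iS]; apply: yS.
  by move=> i j /yp-> /yp->.
exists (A + eps *: unit_laplacian star); split=> //.
have [sA neg zero diag] :=
  weighted_laplacianD irrS star_irr wA (unit_laplacianP star_sym star_irr) eps_gt0.
split=> // [i j ij|i j ij|i].
- by rewrite -starE; exact: neg.
- by rewrite -starE; exact: zero.
by rewrite diag; congr (- _); apply: eq_bigl => k; exact: starE.
Qed.

(** * Rigidity on all vertices is the SSPWL *)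

Lemma centering_eq0_additive K :
  centering_mx R n *m K *m centering_mx R n = 0 ->
  exists a b : 'I_n -> R, forall i j, K i j = a i + b j.
Proof.
rewrite /centering_mx; set t : R := n%:R^-1; set J : 'M[R]_n := const_mx 1.
rewrite mulmxBl mul1mx mulmxBr mulmx1 => /eqP.
rewrite subr_eq0; set M := K - _ => /eqP ME.
exists (fun i => t * \sum_k M i k), (fun j => (t *: J *m K) j j) => i j.
have -> : K i j = M i j + (t *: J *m K) i j by rewrite [M i j]mxE [in RHS]mxE subrK.
congr (_ + _).
  by rewrite ME mxE mulr_sumr; apply: eq_bigr => k _; rewrite -ME !mxE mulr1 mulrC.
by rewrite !mxE; apply: eq_bigr => k _; rewrite !mxE.
Qed.

Lemma SSPWL_of_rigid e r A : simple_graph e -> weighted_laplacian e A ->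
  rigid_on e setT r A -> SSPWL A.
Proof.
move=> [sym irr] wA rigA X sX /matrixP AX0 /matrixP IX0 HKH0.
have [sA neg _ _] := wA.
apply: rigA.
  apply/support_defect_eq0 => //; split=> // i j.
  rewrite /nonedge_in /= !inE /= negb_and !negbK => /orP[/eqP->|eij].
    by have := IX0 j j; rewrite !mxE eqxx mul1r.
  have ij : i != j by apply: contraTneq eij => ->; rewrite irr.
  have /eqP := AX0 i j; rewrite !mxE mulf_eq0.
  by rewrite (negPf (ltr0_neq0 (neg _ _ ij eij))) => /eqP.
have [a [b KE]] := centering_eq0_additive HKH0.
have skew : (commutator_mx A X)^T = - commutator_mx A X.
  by rewrite /commutator_mx linearB /= !trmx_mul sA sX opprB.
have diag i : a i + b i = 0.
  have /matrixP/(_ i i) := skew; rewrite mxE [RHS]mxE /commutator_mx KE; lra.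
apply/matrixP=> i j; rewrite mxE !inE /= /commutator_mx !KE mxE.
by have := diag i; have := diag j; have := diag r; lra.
Qed.

End Laplacian.

Theorem theorem3p11 (R : realType) (n : nat) (hn : (0 < n)%N) (e : rel 'I_n)
    (he : simple_graph e) :
  (exists A : 'M[R]_n, weighted_laplacian e A /\ SSPWL A) <->
  connected_graph e.
Proof.
split=> [[A [wA sspwl]]|conn]; first exact: connected_of_SSPWL wA sspwl.
have [A [wA rig]] := exists_rigid_laplacian R (Ordinal hn) he conn.
by exists A; split=> //; exact: SSPWL_of_rigid rig.
Qed.
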